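(* Let $\mathcal{G}=(S,E)$ and $\mathcal{G}'=(S',E')$ be two graphs on $M$ labels. The following statements are equivalent. a) $\mathcal{G}\le_\Sigma\mathcal{G}'$. b) There exist a matrix $C\in\mathbb{R}^{|S'|\times|S|}_{\ge0}$ satisfying $\sum_{s\in S}C_{s',s}\ge1$ for all $s'\in S'$, and, for each label $\sigma\in\{1,\ldots,M\}$, a matrix $K_\sigma\in\mathbb{R}^{|E'_\sigma|\times|E_\sigma|}_{\ge0}$, such that for every $\sigma\in\{1,\ldots,M\}$ (entrywise inequalities) $$\mathbf{S}^\sigma(\mathcal{G}')\,C\ \ge\ K_\sigma\,\mathbf{S}^\sigma(\mathcal{G}),\qquad \mathbf{D}^\sigma(\mathcal{G}')\,C\ \le\ K_\sigma\,\mathbf{D}^\sigma(\mathcal{G}).$$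
   Context: A graph $\mathcal{G}=(S,E)$ on $M$ labels is a directed labeled graph with finite nonempty node set $S$ and edge set $E\subseteq S\times S\times\{1,\ldots,M\}$; an edge $(s,d,\sigma)$ goes from $s$ to $d$ and has label $\sigma$. $E_\sigma\subseteq E$ denotes the set of edges with label $\sigma$ (and $E'_\sigma$ likewise for $\mathcal{G}'$). VLFC: a Vector Lyapunov Function Candidate is a function $V:\mathbb{R}^n\to\mathbb{R}^N_{\ge0}$ each of whose components is a positive definite quadratic function $V_i(x)=x^\top Q_ix$, $Q_i\succ0$ symmetric. When $N=|S|$, components are indexed by nodes, $V_s$ being the component of node $s$. For a graph $\mathcal{G}=(S,E)$ on $M$ labels and a set of $M$ matrices $\mathcal{A}=\{A_1,\ldots,A_M\}\subset\mathbb{R}^{n\times n}$, $V\sim\mathrm{pclf}(\mathcal{G},\mathcal{A})$ means that $V:\mathbb{R}^n\to\mathbb{R}^{|S|}_{\ge0}$ is a VLFC with $V_d(A_\sigma x)\le V_s(x)$ for all $x\in\mathbb{R}^n$ and all $(s,d,\sigma)\in E$. Ordering: $\mathcal{G}\le_\Sigma\mathcal{G}'$ means that there is a matrix $C\in\mathbb{R}^{|S'|\times|S|}_{\ge0}$ (rows indexed by $S'$, columns by $S$) with $\sum_{s\in S}C_{s',s}\ge1$ for all $s'\in S'$, such that for any dimension $n$, any set $\mathcal{A}$ of $M$ matrices in $\mathbb{R}^{n\times n}$ and any $V\sim\mathrm{pclf}(\mathcal{G},\mathcal{A})$, the VLFC $U=CV:\mathbb{R}^n\to\mathbb{R}^{|S'|}_{\ge0}$,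 i.e. $U_{s'}(x)=\sum_{s\in S}C_{s',s}V_s(x)$, satisfies $U\sim\mathrm{pclf}(\mathcal{G}',\mathcal{A})$. Matrices: for a label $\sigma$, $\mathbf{S}^\sigma(\mathcal{G}),\mathbf{D}^\sigma(\mathcal{G})\in\{0,1\}^{|E_\sigma|\times|S|}$ are given by: for $e\in E_\sigma$, $\mathbf{S}^\sigma_{e,s}=1$ iff $e=(s,d,\sigma)$ for some $d\in S$ (i.e. $s$ is the source of $e$), and $\mathbf{D}^\sigma_{e,d}=1$ iff $e=(s,d,\sigma)$ for some $s\in S$ (i.e. $d$ is the destination of $e$). *)

(* Defs.v *)
From HB Require Import structures.
From mathcomp Require Import all_boot all_order all_algebra.
From mathcomp Require Import reals.

Set Implicit Arguments.
Unset Strict Implicit.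
Unset Printing Implicit Defensive.

Import Order.TTheory GRing.Theory Num.Theory.
Local Open Scope ring_scope.

(* The triple (s, d, sigma) is the edge from s to d with label sigma. *)
Record lgraph (M : nat) := LGraph {
  node : finType;
  node_gt0 : (0 < #|node|)%N;
  edge : {set node * node * 'I_M}
}.

Definition edge_src M (G : lgraph M) (e : node G * node G * 'I_M) := e.1.1.
Definition edge_dst M (G : lgraph M) (e : node G * node G * 'I_M) := e.1.2.
Definition edge_lab M (G : lgraph M) (e : node G * node G * 'I_M) := e.2.

Definition edges_with M (G : lgraph M) (sigma : 'I_M) :
    {set node G * node G * 'I_M} :=
  [set e in edge G | edge_lab e == sigma].

(* Vectors and matrices indexed by S (resp. E_sigma) use the ordinals below
   #|S| (resp. #|E_sigma|), identified with their elements by enum_val and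
   enum_rank. *)

Definition mxle (R : realType) m n (A B : 'M[R]_(m, n)) : Prop :=
  forall i j, A i j <= B i j.

Definition quad_form (R : realType) n (Q : 'M[R]_n) (x : 'cV[R]_n) : R :=
  (x^T *m Q *m x) 0 0.

Definition posdef (R : realType) n (Q : 'M[R]_n) : Prop :=
  Q^T = Q /\ forall x : 'cV[R]_n, x != 0 -> 0 < quad_form Q x.

(* Vector Lyapunov function candidate; that V takes its values in the
   nonnegative orthant follows from positive definiteness. *)
Definition vlfc (R : realType) n N (V : 'cV[R]_n -> 'cV[R]_N) : Prop :=
  forall i : 'I_N, exists Q : 'M[R]_n,
    posdef Q /\ forall x, V x i 0 = quad_form Q x.

Definition pclf (R : realType) M (G : lgraph M) n (A : 'I_M -> 'M[R]_n)
    (V : 'cV[R]_n -> 'cV[R]_#|node G|) : Prop :=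
  vlfc V /\
  forall (x : 'cV[R]_n) (s d : node G) (sigma : 'I_M),
    (s, d, sigma) \in edge G ->
    V (A sigma *m x) (enum_rank d) 0 <= V x (enum_rank s) 0.

Definition admissible (R : realType) m n (C : 'M[R]_(m, n)) : Prop :=
  mxle 0 C /\ forall i, 1 <= \sum_j C i j.

Definition le_sum (R : realType) M (G G' : lgraph M) : Prop :=
  exists C : 'M[R]_(#|node G'|, #|node G|),
    admissible C /\
    forall n (A : 'I_M -> 'M[R]_n) (V : 'cV[R]_n -> 'cV[R]_#|node G|),
      pclf (G := G) A V -> pclf (G := G') A (fun x => C *m V x).

Definition src_mx (R : realType) M (G : lgraph M) (sigma : 'I_M) :
    'M[R]_(#|edges_with G sigma|, #|node G|) :=
  \matrix_(e, s) (edge_src (enum_val e) == enum_val s)%:R.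

Definition dst_mx (R : realType) M (G : lgraph M) (sigma : 'I_M) :
    'M[R]_(#|edges_with G sigma|, #|node G|) :=
  \matrix_(e, d) (edge_dst (enum_val e) == enum_val d)%:R.

(* Main.v *)
Require Import Defs.
From HB Require Import structures.
From mathcomp Require Import all_boot all_order all_algebra.
From mathcomp Require Import reals lra.

Set Implicit Arguments.
Unset Strict Implicit.
Unset Printing Implicit Defensive.

Import Order.TTheory GRing.Theory Num.Theory.
Local Open Scope ring_scope.

(** Multiplying the nonnegative matrix [K] with the Lyapunov inequalities of [G]
    gives b) => a). Conversely, for each edge [e' = (s', d', sigma)] of [G']
    the row of [K_sigma] at [e'] is a nonnegative solution of a linear system. If it had none, Farkas'
    lemma would give [v, w >= 0] with [w_d <= v_s] on all edges [(s, d, sigma)]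
    of [G] and [sum_d C_{d',d} w_d > sum_s C_{s',s} v_s]. A small shift makes
    [v] and [w] positive; then in dimension 2 the forms
    [V_s(x) = v_s x_0^2 + w_s x_1^2], with [A_sigma] sending [e_0] to [e_1] and
    [e_1] to [0] and all other matrices zero, are a Lyapunov function for [G],
    and [C V] violates the inequality of [e'] at [e_0]. *)

(** * Farkas' lemma *)

(* Induction on the number of generators (Bartl's algebraic proof): if [x0]
   separates [b] from all rows but the first row [a], then [a x0 > 0] may be
   scaled to 1, and the other rows and [b] are composed with the projection along
   [x0] onto the kernel of [a]. *)
Lemma farkas (F : realFieldType) m n (A : 'M[F]_(m, n)) (b : 'rV[F]_n) :
  (exists k : 'rV[F]_m, (forall i, 0 <= k 0 i) /\ k *m A = b) \/
  (exists x : 'cV[F]_n,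
    (forall i, (A *m x) i 0 <= 0) /\ 0 < (b *m x) 0 0).
Proof.
elim: m A b => [|m IHm] A b.
  have [->|/eqP b_neq0] := eqVneq b 0.
    by left; exists 0; split=> [[]//|]; rewrite mul0mx.
  right; exists b^T; split=> [[]//|].
  rewrite lt0r; apply/andP; split; last first.
    by rewrite mxE sumr_ge0 // => j _; rewrite mxE -expr2 sqr_ge0.
  apply/eqP=> bb0; apply: b_neq0; apply/rowP=> j; rewrite mxE.
  move: bb0; rewrite mxE => bb0.
  have /eqP: b 0 j * b^T j 0 = 0.
    by apply: (psumr_eq0P _ bb0) => // i _; rewrite mxE -expr2 sqr_ge0.
  by rewrite mxE mulf_eq0 orbb => /eqP.
rewrite -[m.+1]/(1 + m)%N in A *.
rewrite -[A]vsubmxK; move: (usubmx A) (dsubmx A) => a A1.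
have [[k [k_ge0 kA]]|[x [Ax bx]]] := IHm A1 b.
  left; exists (row_mx 0 k); split=> [i|].
    by case: (split_ordP i) => j ->; rewrite ?row_mxEl ?row_mxEr ?mxE.
  by rewrite mul_row_col mul0mx add0r.
have [ax_le0|ax_gt0] := lerP ((a *m x) 0 0) 0.
  right; exists x; split=> // i; rewrite mul_col_mx.
  by case: (split_ordP i) => j ->; rewrite ?col_mxEu ?col_mxEd ?ord1.
pose x0 := ((a *m x) 0 0)^-1 *: x.
have ax0 : a *m x0 = 1%:M.
  rewrite -scalemxAr [a *m x]mx11_scalar scale_scalar_mx mxE eqxx mulr1n.
  by rewrite mulVf // gt_eqF.
have A1x0 i : (A1 *m x0) i 0 <= 0.
  by rewrite -scalemxAr mxE mulr_ge0_le0 // invr_ge0 ltW.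
have bx0 : 0 < (b *m x0) 0 0.
  by rewrite -scalemxAr mxE mulr_gt0 // invr_gt0.
have [[k [k_ge0 kA]]|[y [Ay By]]] :=
  IHm (A1 - A1 *m x0 *m a) (b - b *m x0 *m a).
  (* Expanding [kA] and collecting the multiples of [a] gives this coefficient. It is nonnegative
     because [b x0 > 0], [k >= 0] and [A1 x0 <= 0]. *)
  left; exists (row_mx (b *m x0 - k *m (A1 *m x0)) k); split=> [i|].
    case: (split_ordP i) => j ->; rewrite ?row_mxEl ?row_mxEr //.
    rewrite ord1 mxE [X in _ + X]mxE subr_ge0 (le_trans _ (ltW bx0)) //.
    by rewrite mxE sumr_le0 // => l _; rewrite mulr_ge0_le0.
  rewrite mul_row_col mulmxBl !mulmxA -addrA [- _ + _]addrC.
  by move: kA; rewrite mulmxBr !mulmxA => ->; rewrite addrC subrK.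
right; exists (y - x0 *m (a *m y)).
have restrict p (B : 'M_(p, n)) :
    B *m (y - x0 *m (a *m y)) = (B - B *m x0 *m a) *m y.
  by rewrite mulmxBr mulmxBl !mulmxA.
split=> [i|]; last by rewrite restrict.
rewrite mul_col_mx; case: (split_ordP i) => j ->; rewrite ?col_mxEu ?col_mxEd.
  by rewrite restrict ax0 mul1mx subrr mul0mx mxE.
by rewrite restrict.
Qed.

(** * Positive definite forms and Lyapunov candidates *)

Lemma quad_form_diag (R : realType) n (d : 'rV[R]_n) (x : 'cV[R]_n) :
  quad_form (diag_mx d) x = \sum_i d 0 i * x i 0 ^+ 2.
Proof.
rewrite /quad_form mul_mx_diag mxE; apply: eq_bigr => i _.
by rewrite !mxE mulrAC mulrC.
Qed.

Lemma posdef_diag (R : realType) n (d : 'rV[R]_n) :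
  (forall i, 0 < d 0 i) -> posdef (diag_mx d).
Proof.
move=> d_gt0; split=> [|x x_neq0]; first by rewrite tr_diag_mx.
have term_ge0 i : 0 <= d 0 i * x i 0 ^+ 2.
  by rewrite mulr_ge0 ?sqr_ge0 // ltW.
rewrite quad_form_diag lt0r sumr_ge0 // andbT.
apply: contraNneq x_neq0 => sum0; apply/eqP/colP => i; rewrite mxE.
have /eqP: d 0 i * x i 0 ^+ 2 = 0 by apply: (psumr_eq0P _ sum0).
by rewrite mulf_eq0 gt_eqF //= sqrf_eq0 => /eqP.
Qed.

Lemma quad_form_sum (R : realType) n N (c : 'I_N -> R) (Q : 'I_N -> 'M[R]_n) x :
  quad_form (\sum_j c j *: Q j) x = \sum_j c j * quad_form (Q j) x.
Proof.
rewrite /quad_form mulmx_sumr mulmx_suml summxE; apply: eq_bigr => j _.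
by rewrite -scalemxAr -scalemxAl mxE.
Qed.

Lemma quad_form_ge0 (R : realType) n (Q : 'M[R]_n) x :
  posdef Q -> 0 <= quad_form Q x.
Proof.
move=> [_ Q_gt0]; have [->|/Q_gt0/ltW //] := eqVneq x 0.
by rewrite /quad_form mulmx0 mxE.
Qed.

(** If the combination vanished at some [x != 0], every term would vanish, and since each [Q j] is
    positive at [x], every [c j] would be 0. *)
Lemma posdef_sum (R : realType) n N (c : 'I_N -> R) (Q : 'I_N -> 'M[R]_n) :
  (forall j, 0 <= c j) -> 0 < \sum_j c j -> (forall j, posdef (Q j)) ->
  posdef (\sum_j c j *: Q j).
Proof.
move=> c_ge0 c_gt0 Qpos; split=> [|x x_neq0].
  rewrite raddf_sum; apply: eq_bigr => j _ /=.
  by rewrite linearZ /= (proj1 (Qpos j)).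
have term_ge0 j : 0 <= c j * quad_form (Q j) x.
  by rewrite mulr_ge0 ?quad_form_ge0.
rewrite quad_form_sum lt0r sumr_ge0 // andbT.
apply: contraTneq c_gt0 => sum0; rewrite big1 ?ltxx // => j _.
have /eqP: c j * quad_form (Q j) x = 0 by apply: (psumr_eq0P _ sum0).
rewrite mulf_eq0 => /orP[/eqP // | /eqP qx0].
by have := proj2 (Qpos j) x x_neq0; rewrite qx0 ltxx.
Qed.

Lemma vlfc_ge0 (R : realType) n N (V : 'cV[R]_n -> 'cV[R]_N) x i :
  vlfc V -> 0 <= V x i 0.
Proof. by move=> /(_ i)[Q [Qpos ->]]; apply: quad_form_ge0. Qed.

Lemma vlfc_admissible (R : realType) n m N (C : 'M[R]_(m, N))
    (V : 'cV[R]_n -> 'cV[R]_N) :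
  admissible C -> vlfc V -> vlfc (fun x => C *m V x).
Proof.
move=> [C_ge0 C_ge1] /fin_all_exists[Q /all_and2[Qpos VQ]] i.
exists (\sum_j C i j *: Q j); split.
  apply: posdef_sum => // [j|]; last exact: lt_le_trans ltr01 (C_ge1 i).
  by have := C_ge0 i j; rewrite mxE.
by move=> x; rewrite quad_form_sum mxE; apply: eq_bigr => j _; rewrite VQ.
Qed.

(** * Incidence matrices and the entrywise order *)

Lemma mul_src_mx (R : realType) M (G : lgraph M) sigma p
    (B : 'M[R]_(#|node G|, p)) (e : 'I_#|edges_with G sigma|) j :
  (src_mx R G sigma *m B) e j = B (enum_rank (edge_src (enum_val e))) j.
Proof.
rewrite mxE (bigD1 (enum_rank (edge_src (enum_val e)))) //= !mxE enum_rankK.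
rewrite eqxx mul1r big1 ?addr0 // => i; rewrite !mxE.
by rewrite -(inj_eq enum_val_inj) enum_rankK eq_sym => /negPf->; rewrite mul0r.
Qed.

Lemma mul_dst_mx (R : realType) M (G : lgraph M) sigma p
    (B : 'M[R]_(#|node G|, p)) (e : 'I_#|edges_with G sigma|) j :
  (dst_mx R G sigma *m B) e j = B (enum_rank (edge_dst (enum_val e))) j.
Proof.
rewrite mxE (bigD1 (enum_rank (edge_dst (enum_val e)))) //= !mxE enum_rankK.
rewrite eqxx mul1r big1 ?addr0 // => i; rewrite !mxE.
by rewrite -(inj_eq enum_val_inj) enum_rankK eq_sym => /negPf->; rewrite mul0r.
Qed.

Lemma enum_val_edge M (G : lgraph M) sigma (e : 'I_#|edges_with G sigma|) :
  (edge_src (enum_val e), edge_dst (enum_val e), sigma) \in edge G.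
Proof.
have := enum_valP e; rewrite inE.
by case: (enum_val e) => [[s d] l] /= /andP[eG /eqP <-].
Qed.

Lemma mxle_mul2r (R : realType) m n p (A B : 'M[R]_(m, n)) (D : 'M[R]_(n, p)) :
  mxle A B -> mxle 0 D -> mxle (A *m D) (B *m D).
Proof.
move=> AB D_ge0 i j; rewrite !mxE; apply: ler_sum => l _.
by apply: ler_wpM2r; first by have := D_ge0 l j; rewrite mxE.
Qed.

Lemma mxle_mul2l (R : realType) m n p (A : 'M[R]_(m, n)) (B D : 'M[R]_(n, p)) :
  mxle 0 A -> mxle B D -> mxle (A *m B) (A *m D).
Proof.
move=> A_ge0 BD i j; rewrite !mxE; apply: ler_sum => l _.
by apply: ler_wpM2l; first by have := A_ge0 i l; rewrite mxE.
Qed.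

(** * From the matrix inequalities to the ordering *)

(** Writing S, D and S', D' for the incidence matrices of [G] and [G'], the row of an edge of [G']
    in the chain D' C V(A x) <= K D V(A x) <= K S V(x) <= S' C V(x) is its Lyapunov inequality. The
    outer steps use [V >= 0], the middle one [K >= 0]. *)
Lemma pclf_mulmx (R : realType) M (G G' : lgraph M)
    (C : 'M[R]_(#|node G'|, #|node G|))
    (K : forall sigma : 'I_M,
           'M[R]_(#|edges_with G' sigma|, #|edges_with G sigma|))
    n (A : 'I_M -> 'M[R]_n) (V : 'cV[R]_n -> 'cV[R]_#|node G|) :
  admissible C -> (forall sigma, mxle 0 (K sigma)) ->
  (forall sigma,
     mxle (K sigma *m src_mx R G sigma) (src_mx R G' sigma *m C) /\
     mxle (dst_mx R G' sigma *m C) (K sigma *m dst_mx R G sigma)) ->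
  pclf (G := G) A V -> pclf (G := G') A (fun x => C *m V x).
Proof.
move=> C_adm K_ge0 KC [Vpos Vdecr]; split=> [|x s d sigma sdG'].
  exact: vlfc_admissible.
have [Ksrc Kdst] := KC sigma.
have V_ge0 y : mxle 0 (V y).
  by move=> i j; rewrite ord1 mxE; apply: vlfc_ge0.
have e_in : (s, d, sigma) \in edges_with G' sigma.
  by rewrite inE sdG' /= eqxx.
pose e := enum_rank_in e_in (s, d, sigma).
have eE : enum_val e = (s, d, sigma) by rewrite enum_rankK_in.
have := mxle_mul2r Kdst (V_ge0 (A sigma *m x)) e 0.
have := mxle_mul2r Ksrc (V_ge0 x) e 0.
rewrite -!mulmxA mul_src_mx mul_dst_mx eE /edge_src /edge_dst /=.
move=> src_le dst_le; apply: le_trans dst_le (le_trans _ src_le).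
apply: mxle_mul2l => // f j; rewrite ord1 mul_src_mx mul_dst_mx.
exact: Vdecr (enum_val_edge f).
Qed.

(** * From the ordering to the matrix inequalities *)

(** Here [A sigma] maps [x] to [x_0 e_1], so on an edge labeled [sigma] the inequality is
    [x_0^2 w_d <= x_0^2 v_s + x_1^2 w_s]. For the other labels the left side is 0. *)
Lemma pclf_planar (R : realType) M (G : lgraph M) (sigma : 'I_M)
    (v w : 'cV[R]_#|node G|) :
  (forall i, 0 < v i 0) -> (forall i, 0 < w i 0) ->
  mxle (dst_mx R G sigma *m w) (src_mx R G sigma *m v) ->
  pclf (G := G)
    (fun tau => if tau == sigma then delta_mx 1 0 : 'M[R]_2 else 0)
    (fun x => x 0 0 ^+ 2 *: v + x 1 0 ^+ 2 *: w).
Proof.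
move=> v_gt0 w_gt0 wv; split=> [i|x s d tau sdG].
  exists (diag_mx (\row_(j < 2) if j == 0 then v i 0 else w i 0)); split.
    by apply: posdef_diag => j; rewrite mxE; case: ifP.
  move=> x; rewrite quad_form_diag big_ord_recl big_ord1 !mxE /=.
  by rewrite ![_ ^+ 2 * _]mulrC; congr (_ + _ * x _ _ ^+ 2); apply: val_inj.
case: eqVneq => [tau_eq|_]; last first.
  rewrite mul0mx !mxE expr0n !mul0r addr0.
  by rewrite addr_ge0 // mulr_ge0 ?sqr_ge0 // ltW.
rewrite tau_eq in sdG.
have e_in : (s, d, sigma) \in edges_with G sigma.
  by rewrite inE sdG /= eqxx.
have := wv (enum_rank_in e_in (s, d, sigma)) 0.
rewrite mul_src_mx mul_dst_mx enum_rankK_in // /edge_src /edge_dst /= => wd_le.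
rewrite !mxE !big_ord_recl !big_ord0 !mxE /= !mul0r !addr0 expr0n mul0r add0r.
rewrite mul1r; apply: ler_wpDr; first by rewrite mulr_ge0 ?sqr_ge0 ?ltW.
by apply: ler_wpM2l; rewrite ?sqr_ge0.
Qed.

(** At [e_0] the planar candidate is [v], and at the image [e_1] of [e_0] it is [w]. It needs
    positive [v] and [w], so both are shifted by [eps] first. *)
Lemma le_sum_test (R : realType) M (G G' : lgraph M)
    (C : 'M[R]_(#|node G'|, #|node G|)) sigma (v w : 'cV[R]_#|node G|) :
  admissible C ->
  (forall n (A : 'I_M -> 'M[R]_n) (V : 'cV[R]_n -> 'cV[R]_#|node G|),
      pclf (G := G) A V -> pclf (G := G') A (fun x => C *m V x)) ->
  mxle 0 v -> mxle 0 w ->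
  mxle (dst_mx R G sigma *m w) (src_mx R G sigma *m v) ->
  mxle (dst_mx R G' sigma *m C *m w) (src_mx R G' sigma *m C *m v).
Proof.
move=> [C_ge0 C_ge1] C_le v_ge0 w_ge0 wv e j.
rewrite ord1 -!mulmxA mul_src_mx mul_dst_mx.
set d := enum_rank _; set s := enum_rank _.
(* A common shift preserves the edge inequalities of [G], and adds [eps] times the row sum of [C] to
   each component. *)
have shifted eps : 0 < eps ->
    (C *m w) d 0 + eps * \sum_j C d j <= (C *m v) s 0 + eps * \sum_j C s j.
  move=> eps_gt0; pose shift u : 'cV[R]_#|node G| := u + const_mx eps.
  have shift_gt0 u : mxle 0 u -> forall i, 0 < shift u i 0.
    by move=> u_ge0 i; rewrite !mxE ltr_wpDl //; have := u_ge0 i 0; rewrite mxE.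
  have shift_wv : mxle (dst_mx R G sigma *m shift w)
      (src_mx R G sigma *m shift v).
    move=> f l; have := wv f l; rewrite ord1 !mul_src_mx !mul_dst_mx.
    by rewrite !mxE lerD2r.
  have [_] := C_le _ _ _
    (pclf_planar (shift_gt0 _ v_ge0) (shift_gt0 _ w_ge0) shift_wv).
  move=> /(_ (delta_mx 0 0) _ _ _ (enum_val_edge e)); rewrite eqxx.
  rewrite mul_delta_mx ![delta_mx _ _ _ _]mxE /= expr0n expr1n !scale0r !scale1r
    add0r addr0.
  have shiftE u l : (C *m shift u) l 0 = (C *m u) l 0 + eps * \sum_j C l j.
    rewrite mulmxDr mxE; congr (_ + _); rewrite mxE mulr_sumr.
    by apply: eq_bigr => i _; rewrite mxE mulrC.
  by rewrite !shiftE.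
rewrite leNgt; apply/negP => gap.
have sum_ge0 l : 0 <= \sum_j C l j := le_trans ler01 (C_ge1 l).
(* With this choice [eps] times the row sum at [s] is the gap minus [eps], too small to close the
   gap. *)
pose eps := ((C *m w) d 0 - (C *m v) s 0) / (1 + \sum_j C s j).
have eps_gt0 : 0 < eps by rewrite divr_gt0 ?subr_gt0 // ltr_pwDl.
have epsE : eps * (1 + \sum_j C s j) = (C *m w) d 0 - (C *m v) s 0.
  by rewrite divfK // gt_eqF // ltr_pwDl.
have := shifted eps eps_gt0; have := mulr_ge0 (ltW eps_gt0) (sum_ge0 d).
lra.
Qed.

Lemma farkas_ineq (R : realType) m n (S D : 'M[R]_(m, n)) (c d : 'rV[R]_n) :
  (forall v w : 'cV[R]_n, mxle 0 v -> mxle 0 w -> mxle (D *m w) (S *m v) ->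
     mxle (d *m w) (c *m v)) ->
  exists k : 'rV[R]_m, [/\ mxle 0 k, mxle (k *m S) c & mxle d (k *m D)].
Proof.
move=> dual.
(* The generators below the first block are the slacks of the two systems of
   inequalities. *)
have [[k [k_ge0 kE]]|[x [Ax bx]]] := farkas
  (col_mx (row_mx S D) (block_mx 1%:M 0 0 (- 1%:M))) (row_mx c d).
  (* The coefficients split into [k, t, u >= 0] with [k S + t = c] and [k D - u = d]. *)
  rewrite -[k]hsubmxK -[rsubmx k]hsubmxK in k_ge0 kE.
  move: (lsubmx k) (lsubmx (rsubmx k)) (rsubmx (rsubmx k)) k_ge0 kE.
  move=> {}k t u k_ge0; rewrite mul_row_col mul_mx_row mul_row_block.
  rewrite !mulmx0 !mulmxN !mulmx1 addr0 add0r add_row_mx.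
  move=> /eq_row_mx[<- <-]; exists k; split=> i j; rewrite ord1 !mxE.
  - by have := k_ge0 (lshift _ j); rewrite row_mxEl.
  - rewrite lerDl; have := k_ge0 (rshift _ (lshift _ j)).
    by rewrite row_mxEr row_mxEl.
  - rewrite gerBl; have := k_ge0 (rshift _ (rshift _ j)).
    by rewrite !row_mxEr.
(* The separating vector splits into [p <= 0 <= q] with [S p + D q <= 0] and [c p + d q > 0], so
   [v = - p] and [w = q] contradict [dual]. *)
rewrite -[x]vsubmxK in Ax bx.
move: (usubmx x) (dsubmx x) Ax bx => p q; rewrite mul_col_mx !mul_row_col.
rewrite mul_block_col !mul0mx mulNmx !mul1mx addr0 add0r => Ax bx.
have p_le0 i : p i 0 <= 0.
  by have := Ax (rshift _ (lshift _ i)); rewrite col_mxEd col_mxEu.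
have q_ge0 i : 0 <= q i 0.
  by have := Ax (rshift _ (rshift _ i)); rewrite !col_mxEd mxE oppr_le0.
have /(_ 0 0) : mxle (d *m q) (c *m - p).
  apply: dual => i j; rewrite ord1; first by rewrite !mxE oppr_ge0.
    by rewrite mxE.
  rewrite mulmxN [leRHS]mxE -subr_le0 opprK.
  by have := Ax (lshift _ i); rewrite col_mxEu [leLHS]mxE addrC.
rewrite mulmxN [leRHS]mxE => dq_le; exfalso.
by move: bx; rewrite mxE; lra.
Qed.

Theorem mainTheorem2 (R : realType) (M : nat) (G G' : lgraph M) :
  le_sum R G G' <->
  exists (C : 'M[R]_(#|node G'|, #|node G|))
         (K : forall sigma : 'I_M,
                'M[R]_(#|edges_with G' sigma|, #|edges_with G sigma|)),
    [/\ admissible C,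
        forall sigma : 'I_M, mxle 0 (K sigma) &
        forall sigma : 'I_M,
          mxle (K sigma *m src_mx R G sigma) (src_mx R G' sigma *m C) /\
          mxle (dst_mx R G' sigma *m C) (K sigma *m dst_mx R G sigma)].
Proof.
split=> [[C [C_adm C_le]]|[C [K [C_adm K_ge0 KC]]]]; last first.
  by exists C; split=> // n A V; apply: pclf_mulmx KC.
have rowwise sigma (e : 'I_#|edges_with G' sigma|) :
    exists k : 'rV[R]_#|edges_with G sigma|,
      [/\ mxle 0 k, mxle (k *m src_mx R G sigma) (row e (src_mx R G' sigma *m C))
        & mxle (row e (dst_mx R G' sigma *m C)) (k *m dst_mx R G sigma)].
  apply: farkas_ineq => v w v_ge0 w_ge0 wv i j.
  rewrite -!row_mul [leLHS]mxE [leRHS]mxE.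
  exact: (le_sum_test C_adm C_le v_ge0 w_ge0 wv).
(* With [C] fixed, each condition involves a single row of [K sigma], so rows are chosen
   independently and stacked. *)
have [k kP] := fin_all_exists (fun sigma => fin_all_exists (rowwise sigma)).
exists C, (fun sigma => \matrix_e k sigma e); split=> // sigma.
  move=> e f; have [k_ge0 _ _] := kP sigma e.
  by have := k_ge0 0 f; rewrite !mxE.
have mulE e p (B : 'M_(_, p)) j :
    ((\matrix_e k sigma e) *m B) e j = (k sigma e *m B) 0 j.
  by rewrite -[in RHS](rowK (k sigma)) -row_mul [RHS]mxE.
by split=> e j; have [_ k_src k_dst] := kP sigma e;
  [have := k_src 0 j; rewrite [leRHS]mxE | have := k_dst 0 j; rewrite [leLHS]mxE];
  rewrite mulE.
Qed.
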